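(* Let $D\geq 3$ be an integer. Every graph $G$ of order more than $20D-46$ with $3\leq\delta(G)\leq\Delta(G)\leq D$ contains two vertex-disjoint cycles of different lengths.
   Context: All graphs are finite and simple; $\delta(G)$ and $\Delta(G)$ denote the minimum and maximum degree of $G$. The length of a cycle is its number of vertices. *)

(* Defs.v *)
From mathcomp Require Import all_boot.

Set Implicit Arguments.
Unset Strict Implicit.
Unset Printing Implicit Defensive.

Definition simple_graph (T : finType) (e : rel T) : Prop :=
  symmetric e /\ irreflexive e.

Definition degree (T : finType) (e : rel T) (x : T) : nat :=
  #|[set y | e x y]|.

(* The default value #|T| exceeds every degree of a simple graph, so it is
   irrelevant as soon as the graph has a vertex. *)
Definition min_degree (T : finType) (e : rel T) : nat :=
  \big[minn/#|T|]_(x : T) degree e x.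

Definition max_degree (T : finType) (e : rel T) : nat :=
  \max_(x : T) degree e x.

(* [ucycle e c] also accepts sequences of size at most 2, such as the empty
   sequence or a single edge traversed back and forth. *)
Definition graph_cycle (T : finType) (e : rel T) (c : seq T) : Prop :=
  ucycle e c /\ 3 <= size c.

(* Main.v *)
(* Suppose that any two disjoint cycles have the same length. If a vertex set S
   carries two cycles of different lengths, then G - S is a forest, so it has few
   inner edges and sends many edges to S; counting them against the maximum
   degree bounds the order of G by |S| (D + 1) minus twice the number of edges
   inside S, minus 2. Nine vertices spanning ten edges give exactly
   9 D - 13 <= 20 D - 46.

   Such a set S is a shortest cycle C together with a short path of H = G - C
   joining two neighbours of C. To find the path, apply a longest-path argument
   to H: all cycles in H have length g = |C|, so an end v0 of a longest path
   v0 v1 ... has degree at most 2 in H, and so has v_(g-2), by rotating the path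
   along the chord v0 v_(g-1). Hence both are adjacent to C, and the path
   v0 v_(g-1) v_(g-2) works, unless g = 4. In that case one first discards the
   vertices of degree at most 1 in H; if no short path works, then two overlapping
   4-cycles and a common neighbour in C yield a set S of size 6 with a 4-cycle
   and a 6-cycle. *)

Require Import Defs.
From mathcomp Require Import all_boot zify.
From Stdlib Require Import Classical.

Section Graph.

Variables (T : finType) (e : rel T).
Hypotheses (e_sym : symmetric e) (e_irr : irreflexive e).

(** * Degrees into a vertex set *)

Definition deg_in (A : {set T}) (x : T) : nat := #|[set y in A | e x y]|.

(** Twice the number of edges spanned by [A]: every edge is counted from both ends. *)
Definition deg_sum (A : {set T}) : nat := \sum_(x in A) deg_in A x.

Definition acyclic (A : {set T}) : Prop :=
  forall c, graph_cycle e c -> ~ {subset c <= A}.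

Definition set_path (A : {set T}) (l : seq T) : bool :=
  [&& sorted e l, uniq l & all (mem A) l].

Lemma deg_inE A x : deg_in A x = \sum_(y in A) e x y.
Proof.
rewrite /deg_in -sum1_card big_mkcond [RHS]big_mkcond /=.
by apply: eq_bigr => y _; rewrite inE; case: (y \in A); case: (e x y).
Qed.

Lemma degree_split (A : {set T}) x : degree e x = deg_in A x + deg_in (~: A) x.
Proof.
rewrite /degree /deg_in -(cardsID A); congr (_ + _); apply: eq_card => y.
  by rewrite !inE andbC.
by rewrite !inE.
Qed.

Lemma deg_in_exchange (A B : {set T}) :
  \sum_(x in A) deg_in B x = \sum_(y in B) deg_in A y.
Proof.
under eq_bigr do rewrite deg_inE.
rewrite exchange_big; apply: eq_bigr => y _; rewrite deg_inE.
by apply: eq_bigr => x _; rewrite e_sym.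
Qed.

Lemma deg_in_setU1 (A : {set T}) x y :
  x \notin A -> deg_in (x |: A) y = e y x + deg_in A y.
Proof. by move=> xA; rewrite !deg_inE big_setU1. Qed.

Lemma deg_sum_setU1 (A : {set T}) x :
  x \notin A -> deg_sum (x |: A) = deg_sum A + (deg_in A x).*2.
Proof.
move=> xA; rewrite /deg_sum big_setU1 //= deg_in_setU1 // e_irr add0n.
under eq_bigr do rewrite deg_in_setU1 //.
rewrite big_split /=; under eq_bigr do rewrite e_sym.
by rewrite -deg_inE -addnn; clear; lia.
Qed.

Lemma deg_in_ge2 (A : {set T}) x y z :
  y \in A -> z \in A -> e x y -> e x z -> y != z -> 1 < deg_in A x.
Proof.
move=> yA zA xy xz yz; have <- : #|[set y; z]| = 2 by rewrite cards2 yz.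
apply: subset_leq_card; apply/subsetP => w /set2P[]->; rewrite inE; exact/andP.
Qed.

Lemma deg_in_gt0 (A : {set T}) x y : y \in A -> e x y -> 0 < deg_in A x.
Proof. by move=> yA xy; apply/card_gt0P; exists y; rewrite inE yA. Qed.

(** Pigeonhole; [s] is a list of neighbours to be avoided. *)
Lemma deg_in_ex (A : {set T}) (s : seq T) x :
  size s < deg_in A x -> exists2 y, (y \in A) && e x y & y \notin s.
Proof.
move=> lt; have /subsetPn[y] : ~~ ([set y in A | e x y] \subset s).
  by apply: contraL lt => /subset_leq_card le; rewrite -leqNgt (leq_trans le) ?card_size.
by rewrite inE => yA ys; exists y.
Qed.

(** * Longest paths, forests and the bound on the order *)

Lemma set_path_max (A : {set T}) :
  A != set0 -> exists x t, set_path A (x :: t) /\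
    forall l, set_path A l -> size l <= size (x :: t).
Proof.
case/set0Pn => a aA.
pose P n := [exists l : n.-tuple T, set_path A l].
have P1 : exists n, P n.
  by exists 1; apply/existsP; exists [tuple a]; rewrite /set_path /= aA.
have Pb n : P n -> n <= #|T|.
  case/existsP => l /and3P[_ ul _]; rewrite -(size_tuple l).
  by rewrite -(card_uniqP ul) max_card.
case: (ex_maxnP P1 Pb) => n /existsP[l lA] nmax.
have lmax l' : set_path A l' -> size l' <= size l.
  move=> l'A; rewrite (size_tuple l); apply: nmax.
  by apply/existsP; exists (in_tuple l').
have : 0 < size l by apply: (lmax [:: a]); rewrite /set_path /= aA.
case: {nmax} (l : seq T) lA lmax => [//|x t] lA lmax _.
by exists x, t.
Qed.

Lemma set_path_max_nbr A x t y :
  set_path A (x :: t) ->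
  (forall l, set_path A l -> size l <= size (x :: t)) ->
  y \in A -> e x y -> y \in t.
Proof.
move=> /and3P[s u a] tmax yA xy; apply: contraT => yt.
have := tmax (y :: x :: t); rewrite ltnn; apply.
rewrite /set_path /= in s u a *.
rewrite e_sym xy s inE negb_or yt yA u a !andbT /=.
by apply: contraTneq xy => ->; rewrite e_irr.
Qed.

(* A chord from the first vertex of a path closes a cycle. *)
Lemma set_path_chord A x t y :
  set_path A (x :: t) -> y \in t -> e x y -> 0 < index y t ->
  exists c, [/\ graph_cycle e c, {subset c <= A} & size c = (index y t).+2].
Proof.
move=> /and3P[s u a] yt xy i0.
exists (x :: take (index y t).+1 t).
have ilt : index y t < size t by rewrite index_mem.
have sz : size (take (index y t).+1 t) = (index y t).+1.
  by rewrite size_takel.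
split; last by rewrite /= sz.
  split; last by rewrite /= sz ltnS.
  apply/andP; split.
    rewrite /= rcons_path; apply/andP; split; first exact: take_path.
    rewrite (take_nth x ilt) last_rcons nth_index //.
    by rewrite e_sym.
  rewrite /= in u *; case/andP: u => xt ut; rewrite take_uniq // andbT.
  by apply: contra xt; apply: mem_take.
move=> z; rewrite inE => /orP[/eqP->|/mem_take zt].
  by case/andP: a.
by case/andP: a => _ /allP/(_ _ zt).
Qed.

Lemma acyclic_leaf (A : {set T}) :
  A != set0 -> acyclic A -> exists2 x, x \in A & deg_in A x <= 1.
Proof.
move=> A0 acA; have [x [t [xtA xtmax]]] := set_path_max _ A0.
have xA : x \in A by case/and3P: xtA => _ _ /andP[].
exists x => //; rewrite leqNgt; apply/negP => d2.
(* Avoiding the second vertex of a longest path makes the edge to [y] a chord. The default [x]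
   matters only for empty [t], where [yt] is already absurd. *)
have [y /andP[yA xy] yh] := @deg_in_ex A [:: head x t] x d2.
have yt := set_path_max_nbr _ _ _ _ xtA xtmax yA xy.
have i0 : 0 < index y t.
  case: (t) yt yh => [//|z t'] /= _; rewrite inE eq_sym.
  by case: eqP.
have [c [cc cA _]] := set_path_chord _ _ _ _ xtA yt xy i0.
exact: acA cA.
Qed.

Lemma acyclic_sub (A B : {set T}) : A \subset B -> acyclic B -> acyclic A.
Proof. by move=> /subsetP AB acB c cc cA; apply: (acB c cc) => x /cA/AB. Qed.

(** A nonempty forest has fewer edges than vertices: remove a leaf and induct. *)
Lemma acyclic_deg_sum (A : {set T}) : A != set0 -> acyclic A -> deg_sum A + 2 <= #|A|.*2.
Proof.
move: {2}#|A| (leqnn #|A|) => n; elim: n A => [|n IH] A leA A0 acA.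
  by move: leA; rewrite leqn0 cards_eq0 (negPf A0).
have [x xA dx] := acyclic_leaf _ A0 acA.
have xD : x \notin A :\ x by rewrite !inE eqxx.
have cA := cardsD1 x A; rewrite xA in cA.
have dD : deg_in (A :\ x) x <= 1.
  have := deg_in_setU1 _ x x xD; rewrite setD1K // e_irr; clear -dx; lia.
have := deg_sum_setU1 _ _ xD; rewrite setD1K // => ->.
have [D0|D0] := eqVneq (A :\ x) set0.
  rewrite D0 /deg_sum /deg_in big_set0 cA D0 cards0.
  by rewrite (_ : [set _ in _ | _] = set0) ?cards0 //; apply/setP => y; rewrite !inE.
have acD : acyclic (A :\ x) by apply: acyclic_sub acA; apply: subsetDl.
have := IH (A :\ x) _ D0 acD; clear -dD leA cA; lia.
Qed.

(** Let [F = ~: S] and let [m] be the number of edges between [S] and [F]. Then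
    [3 * #|F| <= deg_sum F + m], the forest bound gives [#|F| + 2 <= m], and
    [m <= #|S| * D - deg_sum S]. *)
Lemma order_le D (S : {set T}) :
  (forall x, 3 <= degree e x <= D) -> ~: S != set0 -> acyclic (~: S) ->
  #|T| + deg_sum S + 2 <= #|S| * D.+1.
Proof.
move=> deg3D F0 acF.
have := acyclic_deg_sum _ F0 acF.
have := cardsC S.
have : \sum_(x in ~: S) 3 <= \sum_(x in ~: S) degree e x.
  by apply: leq_sum => x _; case/andP: (deg3D x).
have : \sum_(x in S) degree e x <= \sum_(x in S) D.
  by apply: leq_sum => x _; case/andP: (deg3D x).
rewrite !sum_nat_const.
under eq_bigr do rewrite (degree_split S).
under [X in _ -> _ <= X -> _]eq_bigr do rewrite (degree_split S).
rewrite !big_split /= (deg_in_exchange (~: S) S).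
rewrite -/(deg_sum S) -/(deg_sum (~: S)) mulnS; clear; lia.
Qed.

(** * Edges spanned by a cycle and an ear *)

Lemma cycle_deg_in c x :
  graph_cycle e c -> x \in c -> 1 < deg_in [set y in c] x.
Proof.
move=> [/andP[cc uc] sc] xc.
have [i s sE] := rot_to xc.
have mc y : (y \in c) = (y \in x :: s) by rewrite -sE mem_rot.
have {cc}: cycle e (x :: s) by rewrite -sE rot_cycle.
have {uc}: uniq (x :: s) by rewrite -sE rot_uniq.
have {sc}: 2 < size (x :: s) by rewrite -sE size_rot.
clear sE; case: s mc => [//|y s] mc; case/lastP: s mc => [//|s z] mc _.
rewrite /= rcons_path last_rcons mem_rcons inE !negb_or.
move=> /and3P[_ /andP[yz _] _] /and3P[xy _ zx].
apply: (deg_in_ge2 _ _ y z) => //; last by rewrite e_sym.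
  by rewrite inE mc !inE eqxx !orbT.
by rewrite inE mc !inE mem_rcons inE eqxx !orbT.
Qed.

Lemma card_seq_set (c : seq T) : uniq c -> #|[set y in c]| = size c.
Proof. by move=> uc; rewrite cardsE; apply/card_uniqP. Qed.

Lemma cycle_deg_sum c :
  graph_cycle e c -> (size c).*2 <= deg_sum [set y in c].
Proof.
move=> cc; have uc : uniq c by case: cc => /andP[].
rewrite -(card_seq_set _ uc) -muln2 -sum_nat_const.
by apply: leq_sum => x; rewrite inE => xc; apply: cycle_deg_in.
Qed.

(** Each vertex of [l] brings at least the edge to its predecessor. *)
Lemma deg_sum_path (A : {set T}) p l :
  p \in A -> path e p l -> uniq l -> (forall x, x \in l -> x \notin A) ->
  deg_sum A + (size l).*2 <= deg_sum (A :|: [set x in l]).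
Proof.
elim: l A p => [|x l IH] A p pA /=.
  by rewrite addn0 (_ : [set _ in _] = set0) ?setU0 //; apply/setP => z; rewrite !inE.
move=> /andP[px pl] /andP[xl ul] lA.
have xA : x \notin A by apply: lA; rewrite mem_head.
have -> : A :|: [set z in x :: l] = (x |: A) :|: [set z in l].
  by apply/setP => z; rewrite !inE orbCA orbA.
have lxA z : z \in l -> z \notin x |: A.
  move=> zl; rewrite !inE negb_or lA ?inE ?zl ?orbT // andbT.
  by apply: contraNneq xl => <-.
apply: leq_trans (IH (x |: A) x (setU11 _ _) pl ul lxA).
rewrite deg_sum_setU1 // doubleS.
have : 0 < deg_in A x by apply: (deg_in_gt0 _ _ p) => //; rewrite e_sym.
clear; lia.
Qed.

(** The cycle gives [size c] edges, the vertices of the ear one each, and the last of them a second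
    one, to [q]. For a one-vertex ear the two end edges differ only if [p != q]. *)
Lemma deg_sum_ear c p q u l :
  graph_cycle e c -> p \in c -> q \in c -> path e u l -> uniq (u :: l) ->
  (forall x, x \in u :: l -> x \notin c) -> e p u -> e q (last u l) ->
  (l != [::]) || (p != q) ->
  (size c + size l).*2 + 4 <= deg_sum ([set y in c] :|: [set y in u :: l]).
Proof.
move=> cc pc qc ul; case/lastP: l ul => [|l v].
  rewrite /= => _ _ uC pu qu /= pq.
  have uc : u \notin [set y in c] by rewrite inE uC ?mem_head.
  have -> : [set y in c] :|: [set y in [:: u]] = u |: [set y in c].
    by apply/setP => z; rewrite !inE orbC.
  rewrite deg_sum_setU1 //.
  have := cycle_deg_sum _ cc.
  have : 1 < deg_in [set y in c] u.
    by apply: (deg_in_ge2 _ _ p q); rewrite ?inE // e_sym.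
  clear; lia.
rewrite rcons_path last_rcons -rcons_cons rcons_uniq => /andP[ul lv].
move=> /andP[vl unl] lc pu qv _.
set A := [set y in c] :|: [set y in u :: l].
have -> : [set y in c] :|: [set y in rcons (u :: l) v] = v |: A.
  by apply/setP => z; rewrite !inE mem_rcons !inE; do ![case: (_ == _)|case: (_ \in _)].
have vc : v \notin c by apply: lc; rewrite mem_rcons mem_head.
have vA : v \notin A by rewrite !inE negb_or vc -in_cons.
rewrite deg_sum_setU1 // size_rcons.
have : 1 < deg_in A v.
  apply: (deg_in_ge2 _ _ q (last u l)); rewrite 1?[e v _]e_sym //.
  - by rewrite !inE qc.
  - by rewrite !inE -in_cons mem_last orbT.
  - apply: contraTneq qc => ->; apply: lc.
    by rewrite mem_rcons inE mem_last orbT.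
have := cycle_deg_sum _ cc.
have : deg_sum [set y in c] + (size (u :: l)).*2 <= deg_sum A.
  apply: (deg_sum_path _ p) => //; rewrite ?inE //= ?pu // => x xl.
  by rewrite inE lc // mem_rcons inE xl orbT.
rewrite /=; clear; lia.
Qed.

(* The two arcs of [c] between [p] and [q], each closed up by [l]. *)
Lemma ear_cycles c p q u l :
  graph_cycle e c -> p \in c -> q \in c -> p != q ->
  path e u l -> uniq (u :: l) ->
  (forall x, x \in u :: l -> x \notin c) -> e p u -> e q (last u l) ->
  exists c1 c2, [/\ graph_cycle e c1, graph_cycle e c2,
    {subset c1 <= c ++ u :: l}, {subset c2 <= c ++ u :: l} &
    size c1 + size c2 = size c + (size (u :: l)).*2 + 2].
Proof.
move=> [/andP[cc uc] _] pc qc pq pl ul lc pu qv.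
have [i s1 s2 _ _ rE] := rot_to_arc uc pc qc pq.
have mc z : (z \in c) = (z \in p :: s1 ++ q :: s2) by rewrite -rE mem_rot.
have sc : size c = (size s1 + size s2).+2.
  by rewrite -(size_rot i c) rE /= size_cat /= addnS.
have {}cc : cycle e (p :: s1 ++ q :: s2) by rewrite -rE rot_cycle.
have {}uc : uniq (p :: s1 ++ q :: s2) by rewrite -rE rot_uniq.
have cc2 : cycle e ((q :: s2) ++ p :: s1).
  by rewrite cycle_catC.
have uc2 : uniq ((q :: s2) ++ p :: s1) by rewrite uniq_catC.
have arc (a b : T) r r' w k : cycle e (a :: r ++ b :: r') -> uniq (a :: r ++ b :: r') ->
    (forall x, x \in a :: r ++ b :: r' -> x \in c) ->
    path e w k -> uniq (w :: k) -> (forall x, x \in w :: k -> x \notin c) ->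
    e b w -> e a (last w k) ->
    graph_cycle e (a :: r ++ b :: w :: k).
  move=> cab uab sub wk uwk wkc bw ka.
  split; last by rewrite /= size_cat /= !addnS !ltnS leq0n.
  apply/andP; split.
    move: cab; rewrite /= !rcons_cat !cat_path /= => /and3P[-> -> _] /=.
    by rewrite bw rcons_path wk e_sym.
  move: uab sub; rewrite -!cat_cons -(cat_rcons b _ r') -(cat_rcons b _ (w :: k)).
  rewrite !cat_uniq => /andP[-> _] sub; rewrite uwk andbT.
  apply/hasPn => x /wkc; apply: contra => xarb; apply: sub.
  by rewrite mem_cat xarb.
(* Together the two cycles use [p], [q] and every vertex of the ear twice, and the other vertices of
   [c] once; this gives the sum of the sizes. *)
exists (q :: s2 ++ p :: u :: l), (p :: s1 ++ q :: rev (u :: l)); split.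
- apply: (arc _ _ _ s1) => // x; rewrite mc => H.
  by rewrite -cat_cons mem_cat orbC -mem_cat.
- rewrite (lastI u l) rev_rcons; apply: (arc _ _ _ s2) => //.
  + by move=> x; rewrite mc.
  + by rewrite rev_path (eq_path (e' := e)) // => x y; rewrite e_sym.
  + by rewrite -rev_rcons -lastI rev_uniq.
  + by move=> x; rewrite -rev_rcons -lastI mem_rev; apply: lc.
  + by case: (l) => [|x l'] //=; rewrite rev_cons last_rcons.
- move=> x; rewrite mem_cat mc /= !inE !mem_cat !inE.
  by do ![case: (_ == _)|case: (_ \in _)].
- move=> x; rewrite mem_cat mc /= !inE !mem_cat !inE mem_rev inE.
  by do ![case: (_ == _)|case: (_ \in _)].
- rewrite /= !size_cat /= size_rev sc /=; clear; lia.
Qed.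


(** * Ends of longest paths when all cycles have length g *)

Lemma end_nbrs (A : {set T}) g x t y :
  (forall c, graph_cycle e c -> {subset c <= A} -> size c = g) ->
  set_path A (x :: t) ->
  (forall l, set_path A l -> size l <= size (x :: t)) ->
  y \in A -> e x y -> y = nth x t 0 \/ y = nth x t (g - 2).
Proof.
move=> cg xtA tmax yA xy.
have yt := set_path_max_nbr _ _ _ _ xtA tmax yA xy.
have [i0|i0] := posnP (index y t); first by left; rewrite -i0 nth_index.
have [c [cc cA sc]] := set_path_chord _ _ _ _ xtA yt xy i0.
(* A chord from [x] to entry [i > 0] of [t] closes a cycle of size [i + 2], so [i = g - 2]. *)
by right; rewrite -(cg c cc cA) sc !subSS subn0 nth_index.
Qed.

Lemma end_deg (A : {set T}) g x t :
  (forall c, graph_cycle e c -> {subset c <= A} -> size c = g) ->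
  set_path A (x :: t) ->
  (forall l, set_path A l -> size l <= size (x :: t)) ->
  deg_in A x <= 2.
Proof.
move=> cg xtA tmax.
apply: leq_trans (_ : #|[set nth x t 0; nth x t (g - 2)]| <= _); last first.
  by rewrite cards2; case: (_ != _).
apply: subset_leq_card; apply/subsetP => y; rewrite !inE => /andP[yA xy].
by have [->|->] := end_nbrs _ _ _ _ _ cg xtA tmax yA xy; rewrite eqxx ?orbT.
Qed.

(* With v0 v1 ... a longest path, y is v_(g-1) and last v1 s is v_(g-2). *)
Lemma end_cycle (A : {set T}) g :
  A != set0 -> (forall x, x \in A -> 1 < deg_in A x) ->
  (forall c, graph_cycle e c -> {subset c <= A} -> size c = g) ->
  exists v0 v1 s y,
  [/\ set_path A (v0 :: v1 :: rcons s y), (size s).+3 = g, e v0 y,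
      deg_in A v0 <= 2 /\ deg_in A (last v1 s) <= 2 &
      forall w, w \in A -> e v1 w -> [\/ w = v0, w = head y s | e w y]].
Proof.
move=> A0 deg2 cg; have [v0 [t [tA tmax]]] := set_path_max _ A0.
have v0A : v0 \in A by case/and3P: tA => _ _ /andP[].
have [y /andP[yA v0y] yh] := deg_in_ex _ [:: head v0 t] _ (deg2 _ v0A).
have yt := set_path_max_nbr _ _ _ _ tA tmax yA v0y.
have d0 := end_deg _ _ _ _ cg tA tmax.
case: t yt yh tA tmax d0 => [//|v1 t] /=; rewrite !inE => + /negPf yv1.
rewrite yv1 /= => yt tA tmax d0.
have [c [cc cA sc]] : exists c, [/\ graph_cycle e c, {subset c <= A} &
    size c = (index y (v1 :: t)).+2].
  by apply: (set_path_chord _ v0) => //=; rewrite ?inE ?yt ?orbT // eq_sym yv1.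
have {c cc cA sc} sg : (index y t).+3 = g.
  by rewrite -(cg c cc cA) sc /= eq_sym yv1.
case/and3P: (tA) => ptA utA atA.
move: yt sg tA tmax ptA utA atA; case/splitPr => s s2.
have [ys|ys] := boolP (y \in s).
  move=> _ _ _ _; rewrite -!cat_cons cat_uniq /= !inE.
  by rewrite ys !orbT andbF.
move=> sg tA tmax ptA utA atA.
rewrite index_cat (negPf ys) /= eqxx addn0 in sg.
exists v0, v1, s, y; split => //.
- apply/and3P; split.
  + by move: ptA; rewrite /= -cat_rcons cat_path => /and3P[-> ->].
  + by move: utA; rewrite -cat_rcons -!cat_cons cat_uniq; case/and3P.
  + by move: atA; rewrite -cat_rcons -!cat_cons all_cat; case/andP.
- split => //.
  (* Traversing the initial segment up to [last v1 s] backwards and going on along the edge from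
     [v0] to [y] gives a path on the same vertices, hence again a longest one. *)
  have rA : set_path A (last v1 s :: rev (belast v0 (v1 :: s)) ++ y :: s2).
    have E : last v1 s :: rev (belast v0 (v1 :: s)) = rev (v0 :: v1 :: s).
      by rewrite (lastI v0 (v1 :: s)) rev_rcons.
    apply/and3P; split.
    + move: ptA; rewrite /= !cat_path /= => /and4P[v01 v1s _ ys2].
      rewrite -(last_cons v0 v1 s) rev_path.
      rewrite (eq_path (e' := e)) => [|a b]; last by rewrite e_sym.
      rewrite /= v01 v1s /= rev_cons last_rcons v0y ys2.
      by [].
    + rewrite -cat_cons E; move: utA; rewrite -!cat_cons !cat_uniq rev_uniq.
      move=> /and3P[-> H ->]; rewrite andbT; apply: contra H.
      by apply: sub_has => a; rewrite /= mem_rev.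
    + by rewrite -cat_cons E all_cat all_rev -all_cat.
  apply: end_deg cg rA _ => l /tmax; congr (_ <= _).
  by rewrite /= !size_cat size_rev /= size_belast addSn.
- move=> w wA v1w.
  have [->|wv0] := eqVneq w v0; first by constructor 1.
  set r := s ++ y :: s2 in tA tmax ptA utA atA.
  have tA1 : set_path A (v1 :: r).
    apply/and3P; split; first by case/andP: ptA.
      by case/andP: utA.
    by case/andP: atA.
  have [wt|wt] := boolP (w \in r).
    have [i0|i0] := posnP (index w r).
      constructor 2; rewrite -(nth_index w wt) i0 /r.
      by case: (s).
    have [c [cc cA sc]] := set_path_chord _ _ _ _ tA1 wt v1w i0.
    (* The chord from [v1] closes a cycle of length [g], so [w] is the vertex right after [y] on the
       path. *)
    have iw : index w r = (size s).+1 by move: (cg c cc cA); rewrite sc -sg => -[].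
    constructor 3; rewrite -(nth_index w wt) iw /r nth_cat ltnNge leqnSn /=.
    rewrite subSn // subnn /= e_sym.
    move: ptA; rewrite /r /= cat_path /= => /and4P[_ _ _].
    case: s2 @r wt iw {tA tmax utA atA tA1 i0 sc} => [|a s2] r wt iw /=.
      move: wt; by rewrite -index_mem iw /r size_cat addn1 ltnn.
    by case/andP.
  (* Off the path, [w] can replace [v0] as the end of a longest path, so its neighbour other than
     [v1] must be [y]. *)
  have wA' : set_path A (w :: v1 :: r).
    case/and3P: tA1 => p1 u1 a1.
    apply/and3P; split.
    + by rewrite /= e_sym v1w.
    + rewrite /= in u1 *; rewrite u1 andbT inE negb_or wt andbT.
      by apply: contraTneq v1w => ->; rewrite e_irr.
    + by rewrite /= in a1 *; rewrite wA.
  have wmax l : set_path A l -> size l <= size (w :: v1 :: r) by apply: tmax.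
  have [y' /andP[y'A wy'] y'v1] := deg_in_ex _ [:: v1] _ (deg2 _ wA).
  constructor 3.
  have [y'E|y'E] := end_nbrs _ _ _ _ _ cg wA' wmax y'A wy'.
    by move: y'v1; rewrite y'E inE eqxx.
  move: wy'; rewrite y'E -sg !subSS subn0 /=.
  by rewrite /r nth_cat ltnn subnn.
Qed.


Lemma shortest_cycle (A : {set T}) :
  A != set0 -> (forall x, x \in A -> 1 < deg_in A x) ->
  exists2 c, graph_cycle e c & forall c', graph_cycle e c' -> size c <= size c'.
Proof.
move=> A0 deg2; pose P n := [exists c : n.-tuple T, ucycleb e c && (2 < size c)].
have cP c : graph_cycle e c -> P (size c).
  by case=> uc sc; apply/existsP; exists (in_tuple c); apply/andP.
have [n Pn] : exists n, P n.
  apply: NNPP => noP; have acA : acyclic A.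
    by move=> c /cP Pc _; apply: noP; exists (size c).
  have [x xA] := acyclic_leaf _ A0 acA.
  by rewrite leqNgt deg2.
case: (ex_minnP (ex_intro _ n Pn)) => m /existsP[c /andP[uc sc]] mmin.
exists c => // c' /cP /mmin; by rewrite size_tuple.
Qed.

(** * Graphs whose disjoint cycles all have equal length *)

Section EqualLengths.

Variable D : nat.
Hypotheses (D3 : 3 <= D) (deg3D : forall x, 3 <= degree e x <= D)
  (orderD : 20 * D - 46 < #|T|)
  (eq_len : forall c1 c2, graph_cycle e c1 -> graph_cycle e c2 ->
     [disjoint c1 & c2] -> size c1 = size c2).

(** A cycle outside [S] would be disjoint from both [c1] and [c2], so it would have both lengths. *)
Lemma acyclicC (S : {set T}) c1 c2 :
  graph_cycle e c1 -> graph_cycle e c2 -> {subset c1 <= S} -> {subset c2 <= S} ->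
  size c1 != size c2 -> acyclic (~: S).
Proof.
move=> cc1 cc2 c1S c2S /eqP ne c cc cS; apply: ne.
have dj (c' : seq T) : {subset c' <= S} -> [disjoint c & c'].
  move=> c'S; rewrite disjoint_has; apply/hasPn => x /cS; rewrite inE.
  by apply: contra => /c'S.
by rewrite -(eq_len _ _ cc cc1 (dj _ c1S)) (eq_len _ _ cc cc2 (dj _ c2S)).
Qed.

(** The bound [order_le] yields order at most [9 * D - 13] in the first case and [8 * D - 10] in the
    second. For [D >= 3] neither exceeds [20 * D - 46]; all three are 14 at [D = 3]. *)
Lemma dense_cyclic (S : {set T}) :
  acyclic (~: S) ->
  (#|S| <= 9 /\ (#|S|).*2 + 2 <= deg_sum S) \/
  (#|S| <= 8 /\ (#|S|).*2 <= deg_sum S) -> False.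
Proof.
move=> acS dS; have F0 : ~: S != set0.
  by rewrite -card_gt0; have := cardsC S; clear -dS orderD D3; lia.
have := order_le _ _ deg3D F0 acS.
have : 1 <= D by clear -D3; lia.
(* With [D = d + 1] the only nonlinear term left is [#|S| * d], which [leq_mul] bounds. *)
case: (D) D3 orderD => // d d3 ltT _; rewrite !mulnS.
case: dS => -[sS dS].
  have := leq_mul sS (leqnn d); clear -sS dS d3 ltT; lia.
have := leq_mul sS (leqnn d); clear -sS dS d3 ltT; lia.
Qed.

(** * Short ears on a shortest cycle *)

Variable C : seq T.
Hypotheses (C_cycle : graph_cycle e C)
  (C_min : forall c, graph_cycle e c -> size C <= size c).

Let H := ~: [set y in C].

Let inH x : (x \in H) = (x \notin C).
Proof. by rewrite !inE. Qed.

Lemma cycle_avoid_size c : graph_cycle e c -> {subset c <= H} -> size c = size C.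
Proof.
move=> cc cH; apply: eq_len => //; rewrite disjoint_has; apply/hasPn => x /cH.
by rewrite inH.
Qed.

(** All degrees are at least 3, so a vertex with few neighbours in [H] has the others on [C]. *)
Lemma C_nbr (s : seq T) x :
  deg_in H x + size s < 3 -> exists2 p, p \in C /\ e x p & p \notin s.
Proof.
move=> lt; have /andP[d3 _] := deg3D x.
have [|p /andP[pC xp] ps] := deg_in_ex [set y in C] s x.
  have := degree_split [set y in C] x; rewrite -/H; clear -lt d3; lia.
by exists p => //; rewrite inE in pC.
Qed.

(* The excluded values of [size C] are those for which the cycles made of the ear
   and an arc of C may all have length [size C]. *)
Lemma no_short_ear p q u l :
  p \in C -> q \in C -> path e u l -> uniq (u :: l) -> {subset u :: l <= H} ->
  e p u -> e q (last u l) -> size C + size (u :: l) <= 9 ->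
  (p != q) && (size C != (size (u :: l)).*2 + 2) ||
  [&& p == q, l != [::] & size C != (size (u :: l)).+1] -> False.
Proof.
move=> pC qC pl ul lH pu qv sCl pq.
have lC x : x \in u :: l -> x \notin C by move/lH; rewrite inH.
set S := [set y in C] :|: [set y in u :: l].
have CS : {subset C <= S} by move=> x xC; rewrite !inE xC.
have lS : {subset u :: l <= S} by move=> x xl; rewrite in_setU orbC inE xl.
have ClS : {subset C ++ u :: l <= S}.
  by move=> x; rewrite mem_cat => /orP[/CS|/lS].
have uC : uniq C by case: C_cycle => /andP[].
have cardS : #|S| = size C + size (u :: l).
  rewrite cardsU (_ : _ :&: _ = set0).
    by rewrite cards0 subn0 !card_seq_set.
  apply/setP => x; rewrite !inE -in_cons andbC.
  by case: (boolP (_ \in _)) => // /lC/negPf.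
(* For [p != q] the two cycles through the ear have sizes with sum [size C + 2 * size (u :: l) + 2],
   so both equal [size C] only at the excluded value. For [p = q] the ear and [p] form a cycle. *)
have [c cc [cS sc]] : exists2 c, graph_cycle e c & {subset c <= S} /\ size C != size c.
  case/orP: pq => [/andP[pq sC]|/and3P[/eqP pq l0 sC]].
    have [c1 [c2 [cc1 cc2 c1S c2S sE]]] :=
      ear_cycles _ _ _ _ _ C_cycle pC qC pq pl ul lC pu qv.
    have [E|ne] := eqVneq (size C) (size c1).
      exists c2 => //; split; first by move=> x /c2S/ClS.
      by apply: contra sC => /eqP E2; apply/eqP; clear -E E2 sE; lia.
    by exists c1 => //; split => // x /c1S/ClS.
  exists (p :: u :: l); last first.
    by split => // x; rewrite inE => /orP[/eqP->|/lS//]; apply: CS.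
  split; last by case: (l) l0.
  apply/andP; split; last by rewrite cons_uniq ul andbT; apply: contraL pC => /lC.
  by rewrite /= rcons_path pu pl /= e_sym pq.
apply: (dense_cyclic S (acyclicC _ _ _ C_cycle cc CS cS sc)); left.
rewrite cardS; split => //.
have -> : (size C + size (u :: l)).*2 + 2 = (size C + size l).*2 + 4.
  by rewrite /=; clear; lia.
apply: (deg_sum_ear _ p q) => //; case/orP: pq => [/andP[-> _]|/and3P[_ -> _] //].
by rewrite orbT.
Qed.

(** The two cycles through [x] have total size [size C + 4], and neither is shorter than [C]. *)
Lemma two_nbrs_girth p q x :
  x \in H -> p \in C -> q \in C -> p != q -> e x p -> e x q -> size C <= 4.
Proof.
rewrite inH e_sym [e x q]e_sym => xC pC qC pq px qx.
have [|c1 [c2 [cc1 cc2 _ _]]] :=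
  ear_cycles C p q x [::] C_cycle pC qC pq isT isT _ px qx.
  by move=> y; rewrite inE => /eqP->.
have := C_min _ cc1; have := C_min _ cc2; rewrite /=; clear; lia.
Qed.

Lemma adjacent_nbrs_girth p q x y :
  x \in H -> y \in H -> p \in C -> q \in C -> e x y -> e x p -> e y q -> size C <= 6.
Proof.
rewrite !inH e_sym [e x p]e_sym [e y q]e_sym => xC yC pC qC yx px qy.
have xy : e x y by rewrite e_sym.
have nxy : x != y by apply: contraTneq xy => ->; rewrite e_irr.
have [pq|pq] := eqVneq p q.
  apply: (@leq_trans 3) => //; apply: (C_min [:: p; x; y]); split => //.
  rewrite /ucycle /= px xy pq [e y q]e_sym qy !inE nxy -pq !andbT /=.
  by rewrite negb_or; apply/andP; split; apply: contraTneq pC => ->.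
have [|||c1 [c2 [cc1 cc2 _ _]]] :=
  ear_cycles C p q x [:: y] C_cycle pC qC pq _ _ _ px qy.
- by rewrite /= xy.
- by rewrite /= inE nxy.
- by move=> z; rewrite !inE => /orP[]/eqP->.
have := C_min _ cc1; have := C_min _ cc2; rewrite /=; clear; lia.
Qed.

(** If [C] were spanning, a third neighbour of one of its vertices would give a chord and so a
    shorter cycle. *)
Lemma compl_shortest_neq0 : H != set0.
Proof.
apply/eqP => H0; have [/andP[cC uC] sC] := C_cycle.
have inC x : x \in C by rewrite -[x \in C]negbK -inH H0 inE.
case: C cC uC sC inC C_min => [//|x t] cC uC sC inC tmin.
have tT : set_path setT (x :: t).
  apply/and3P; split => //; last by apply/allP => y; rewrite /= inE.
  by move: cC; rewrite /= rcons_path => /andP[].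
have [|y /andP[_ xy]] := deg_in_ex setT [:: head x t; last x t] x.
  have /andP[d3 _] := deg3D x; have := degree_split setT x.
  by rewrite setCT (deg_inE set0) big_set0 addn0 => <-.
rewrite !inE negb_or => /andP[yh yl].
have yt : y \in t.
  have := inC y; rewrite inE => /orP[/eqP yx|//].
  by move: xy; rewrite yx e_irr.
have i0 : 0 < index y t.
  by case: (t) yt yh => [//|z t'] /= _; rewrite eq_sym; case: eqP.
have [c [cc _ sc]] := set_path_chord _ _ _ _ tT yt xy i0.
have := tmin _ cc; rewrite sc /= ltnS => le.
have ix := index_mem y t; rewrite yt in ix.
have iE : index y t = (size t).-1.
  by apply/eqP; rewrite -eqSS prednK ?(leq_ltn_trans (leq0n _) ix) // eqn_leq ix.
by move: yl; rewrite -nth_last -iE nth_index ?eqxx.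
Qed.

Lemma girth4 : size C = 4.
Proof.
apply/eqP; apply: contraT => /eqP g4; exfalso.
(* Otherwise [x] has two neighbours on [C], which forces girth 3, and [x] alone is a forbidden
   ear. *)
have deg2 x : x \in H -> 1 < deg_in H x.
  move=> xH; rewrite ltnNge; apply/negP => d1.
  have [|p [pC xp] _] := C_nbr [::] x; first by rewrite /=; clear -d1; lia.
  have [|q [qC xq] qp] := C_nbr [:: p] x; first by rewrite /=; clear -d1; lia.
  rewrite inE eq_sym in qp.
  have gle := two_nbrs_girth _ _ _ xH pC qC qp xp xq.
  apply: (no_short_ear p q x [::]) => //; rewrite 1?e_sym //.
  - by move=> y; rewrite inE => /eqP->.
  - by rewrite /=; clear -gle; lia.
  - by rewrite qp /=; apply/orP; left; apply/eqP.
have [v0 [v1 [s [y [/and3P[]]]]]] :=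
  end_cycle _ _ compl_shortest_neq0 deg2 cycle_avoid_size.
move=> pv uv aH sg v0y [d0 dz] nv1.
have vH : {subset v0 :: v1 :: rcons s y <= H} by move=> x /(allP aH).
have v0H : v0 \in H by apply: vH; rewrite mem_head.
have v1H : v1 \in H by apply: vH; rewrite !inE eqxx orbT.
have yH : y \in H by apply: vH; rewrite !inE mem_rcons mem_head !orbT.
have zH : last v1 s \in H.
  by apply: vH; rewrite inE -rcons_cons mem_rcons inE mem_last !orbT.
move: pv; rewrite /= rcons_path => /and3P[v01 v1s zy].
move: uv; rewrite -rcons_cons cons_uniq rcons_uniq mem_rcons inE negb_or.
move=> /and3P[/andP[v0y' v0s] ys us].
have [|p [pC v0p] _] := C_nbr [::] v0; first by rewrite addn0.
have [|q [qC zq] _] := C_nbr [::] (last v1 s); first by rewrite addn0.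
(* If the girth is at least 7, a third neighbour of [v1] in [H] would lie on a 4-cycle with [v0],
   [v1] and [y]. So [v1], like [v0], has a neighbour on [C], and this forces girth at most 6. *)
have gle6 : size C <= 6.
  rewrite leqNgt; apply/negP => g7.
  have d1 : deg_in H v1 <= 2.
    rewrite leqNgt; apply/negP => d1.
    have [w /andP[wH v1w]] := deg_in_ex _ [:: v0; head y s] _ d1.
    rewrite !inE negb_or => /andP[wv0 wh].
    case: (nv1 w wH v1w) => [E|E|wy]; [by rewrite E eqxx in wv0|by rewrite E eqxx in wh|].
    suff : size C <= 4 by clear -g7; lia.
    apply: (C_min [:: v0; v1; w; y]); split => //.
    rewrite /ucycle /= v01 v1w wy e_sym v0y /= !inE !negb_or v0y' [v0 == w]eq_sym wv0.
    move: v0s ys; rewrite !inE !negb_or [y == v1]eq_sym => /andP[-> _] /andP[-> _] /=.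
    rewrite !andbT; apply/andP; split.
      by apply: contraTneq v1w => ->; rewrite e_irr.
    by apply: contraTneq wy => ->; rewrite e_irr.
  have [|r [rC v1r] _] := C_nbr [::] v1; first by rewrite addn0.
  have := adjacent_nbrs_girth _ _ _ _ v0H v1H pC rC v01 v0p v1r; clear -g7; lia.
(* A three-vertex ear: [6 + 3 <= 9], and the excluded girths are 8 for [p != q] and 4 for
   [p = q]. *)
apply: (no_short_ear p q v0 [:: y; last v1 s]) => //.
- by rewrite /= v0y e_sym zy.
- rewrite /= !inE negb_or v0y' andbT /=.
  apply/andP; split; first by apply: contraNneq v0s => ->; apply: mem_last.
  by apply: contraNneq ys => ->; apply: mem_last.
- by apply/allP; rewrite /= v0H yH zH.
- by rewrite e_sym.
- by rewrite /= e_sym.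
- by rewrite /=; clear -gle6; lia.
- by case: eqP => _ /=; rewrite ?orbF; apply/eqP; clear -g4 gle6; lia.
Qed.

(** * Girth four *)

Lemma no_ear p q u l :
  p \in C -> q \in C -> p != q -> path e u l -> uniq (u :: l) ->
  {subset u :: l <= H} -> e u p -> e (last u l) q -> 0 < size l <= 4 -> False.
Proof.
move=> pC qC pq pl ul lH; rewrite e_sym [e _ q]e_sym => up vq /andP[l0 l4].
(* One vertex is too few because [4 = 2 * 1 + 2]; five is the maximum because [4 + 5 = 9]. *)
apply: (no_short_ear p q u l) => //; rewrite girth4 /=.
  by clear -l4; lia.
by rewrite pq /=; apply/orP; left; apply/eqP; clear -l0; lia.
Qed.

(** A vertex of degree at most 1 in [H] has two neighbours on [C], one of them different from
    [q]. *)
Lemma no_leaf_path x l q :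
  deg_in H x <= 1 -> q \in C -> path e x l -> uniq (x :: l) ->
  {subset x :: l <= H} -> e (last x l) q -> 0 < size l <= 4 -> False.
Proof.
move=> d1 qC; have [|p [pC xp] pq] := C_nbr [:: q] x; first by rewrite /=; clear -d1; lia.
by rewrite inE in pq => *; apply: (no_ear p q x l).
Qed.

(** A single round of deletions suffices: [H'_deg] shows that minimum degree 2 is reached. *)
Let H' := [set x in H | 1 < deg_in H x].

Let H'_neq0 : H' != set0.
Proof.
(* Every cycle of [H] lies in [H']; were [H'] empty, [H] would be a forest, and the four vertices of
   [C] are dense enough to refute this. *)
apply/eqP => H'0; apply: (dense_cyclic [set y in C]); last first.
  right; have uC : uniq C by case: C_cycle => /andP[].
  by rewrite card_seq_set // girth4; split => //; rewrite -girth4 cycle_deg_sum.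
move=> c cc cH; have [_ sc] := cc; case: c cc cH sc => [//|x c] cc cH _.
have : x \in H'.
  rewrite inE (cH _ (mem_head _ _)).
  apply: leq_trans (cycle_deg_in _ _ cc (mem_head _ _)) _.
  apply: subset_leq_card; apply/subsetP => y; rewrite inE => /andP[yc xy].
  by rewrite inE xy cH //; move: yc; rewrite inE.
by rewrite H'0 inE.
Qed.

Let other_nbr x : x \in H' -> forall s, deg_in H' x + size s < deg_in H x ->
  exists2 y, [/\ y \in H, deg_in H y <= 1 & e x y] & y \notin s.
Proof.
move=> xH s lt; have [|y /andP[yH xy]] := deg_in_ex H (enum [set w in H' | e x w] ++ s) x.
  by rewrite size_cat -cardE.
rewrite mem_cat mem_enum negb_or inE xy andbT => /andP[yH' ys].
by exists y => //; split => //; move: yH'; rewrite inE yH /= -leqNgt.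
Qed.

(** Otherwise [x] has a discarded neighbour [y], and either a neighbour on [C] or a second discarded
    neighbour [z]. Then [y x] or [y x z] is a forbidden ear. *)
Let H'_deg x : x \in H' -> 1 < deg_in H' x.
Proof.
move=> xH'; rewrite ltnNge; apply/negP => d1.
have /setIdP[xH d2] := xH'.
have [|y [yH y1 xy] _] := other_nbr x xH' [::]; first by rewrite addn0 (leq_ltn_trans d1).
have yx : e y x by rewrite e_sym.
have nyx : y != x by apply: contraTneq yx => ->; rewrite e_irr.
have d3 : 2 < deg_in H x.
  rewrite ltnNge; apply/negP => d2'.
  have [|q [qC xq] _] := C_nbr [::] x; first by rewrite addn0.
  apply: (no_leaf_path y [:: x] q) => //=; rewrite ?yx ?inE ?nyx //.
  by apply/allP; rewrite /= yH xH.
have [|z [zH z1 xz]] := other_nbr x xH' [:: y]; first by rewrite /=; clear -d1 d3; lia.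
rewrite inE => zy.
have nxz : x != z by apply: contraTneq xz => ->; rewrite e_irr.
have [|q [qC zq] _] := C_nbr [::] z; first by rewrite /=; clear -z1; lia.
apply: (no_leaf_path y [:: x; z] q) => //=.
- by rewrite yx xz.
- by rewrite !inE negb_or nyx nxz eq_sym zy.
- by apply/allP; rewrite /= yH xH zH.
Qed.

Let H'_attached x : x \in H' -> deg_in H' x <= 2 ->
  (exists2 p, p \in C & e x p) \/ exists y, [/\ y \in H, deg_in H y <= 1 & e x y].
Proof.
move=> xH' d2; have [d3|d3] := ltnP 2 (deg_in H x).
  right; have [|y yP _] := other_nbr x xH' [::]; last by exists y.
  by rewrite addn0; clear -d2 d3; lia.
by left; have [|p [pC xp] _] := C_nbr [::] x; [rewrite addn0|exists p].
Qed.

Lemma equal_lengths_absurd : False.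
Proof.
have cH' c : graph_cycle e c -> {subset c <= H'} -> size c = 4.
  move=> cc cS; rewrite -girth4; apply: cycle_avoid_size => // x /cS.
  by case/setIdP.
have [v0 [v1 [s [v3 [/and3P[]]]]]] := end_cycle _ _ H'_neq0 H'_deg cH'.
case: s => [//|v2 [|//]] /=.
move=> /and4P[v01 v12 v23 _] uv /and5P[v0H' v1H' v2H' v3H' _] _ v03 [d0 d2] nv1.
have H'H x : x \in H' -> x \in H by case/setIdP.
have leafH' x v : deg_in H x <= 1 -> v \in H' -> x != v.
  by move=> x1 /setIdP[_ dv]; apply: contraTneq x1 => ->; rewrite -ltnNge.
have [v10 v21] : e v1 v0 /\ e v2 v1 by rewrite e_sym v01 e_sym v12.
have [v32 v30] : e v3 v2 /\ e v3 v0 by rewrite e_sym v23 e_sym v03.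
move: uv; rewrite /= !inE !negb_or => /and4P[/and3P[n01 n02 n03] /andP[n12 n13] n23 _].
(* Otherwise [v0] has a discarded neighbour [x], and the path [x v0 v1 v2], extended if necessary by
   a discarded neighbour of [v2], is a forbidden ear. *)
have v0_C : exists2 p, p \in C & e v0 p.
  have [//|[x [xH x1 v0x]]] := H'_attached _ v0H' d0; exfalso.
  have xv0 : e x v0 by rewrite e_sym.
  have nx v : v \in H' -> x != v by apply: leafH'.
  have [[q qC v2q]|[y [yH y1 v2y]]] := H'_attached _ v2H' d2.
    apply: (no_leaf_path x [:: v0; v1; v2] q) => //=.
    - by rewrite xv0 v01 v12.
    - by rewrite !inE !negb_or !nx // n01 n02 n12.
    - by apply/allP; rewrite /= ?xH ?yH !H'H.
  have yv2 : e y v2 by rewrite e_sym.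
  have ny v : v \in H' -> v != y by rewrite eq_sym; apply: leafH'.
  have nxy : x != y.
    apply: contraTneq x1 => xy; rewrite -ltnNge.
    by apply: (deg_in_ge2 _ _ v0 v2); rewrite ?H'H // xy.
  have [|q [qC yq] _] := C_nbr [::] y; first by rewrite addn0; apply: leq_trans y1 _.
  apply: (no_leaf_path x [:: v0; v1; v2; y] q) => //=.
  - by rewrite xv0 v01 v12 v2y.
  - by rewrite !inE !negb_or nxy !nx // n01 n02 n12 !ny.
  - by apply/allP; rewrite /= xH yH !H'H.
have [p pC v0p] := v0_C.
have [q qC v2q] : exists2 q, q \in C & e v2 q.
  have [//|[y [yH y1 v2y]]] := H'_attached _ v2H' d2; exfalso.
  have yv2 : e y v2 by rewrite e_sym.
  have ny v : v \in H' -> y != v by apply: leafH'.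
  apply: (no_leaf_path y [:: v2; v1; v0] p) => //=.
  - by rewrite yv2 v21 v10.
  - by rewrite !inE !negb_or !ny // ![v2 == _]eq_sym n12 n02 eq_sym n01.
  - by apply/allP; rewrite /= ?xH ?yH !H'H.
have pq : p = q.
  apply/eqP; apply: contraT => pq; exfalso.
  apply: (no_ear p q v0 [:: v1; v2]) => //=.
  - by rewrite v01 v12.
  - by rewrite !inE negb_or n01 n02 n12.
  - by apply/allP; rewrite /= ?xH ?yH !H'H.
have notC x : x \in H' -> x != p.
  by move/H'H; rewrite inH; apply: contraNneq => ->.
(* For [r != p] the edge from [v0] to [v1] is a forbidden ear; for [r = p] there is a triangle,
   against girth 4. *)
have v1_C r : r \in C -> e v1 r -> False.
  move=> rC v1r; have [rp|rp] := eqVneq p r; last first.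
    apply: (no_ear p r v0 [:: v1]) => //=; rewrite ?v01 ?inE ?n01 //.
    by apply/allP; rewrite /= ?xH ?yH !H'H.
  have : size C <= 3; last by rewrite girth4.
  apply: (C_min [:: v0; v1; p]); split => //.
  by rewrite /ucycle /= v01 rp v1r e_sym -rp v0p !inE negb_or n01 !notC.
have v1_leaf x : x \in H -> deg_in H x <= 1 -> e v1 x -> False.
  move=> xH x1 v1x; have nx v : v \in H' -> x != v by apply: leafH'.
  apply: (no_leaf_path x [:: v1; v0] p) => //=.
  - by rewrite e_sym v1x v10.
  - by rewrite !inE !negb_or !nx // eq_sym n01.
  - by apply/allP; rewrite /= ?xH ?yH !H'H.
(* A third neighbour [w] of [v1] is neither on [C] nor discarded, so it lies in [H'] and [end_cycle]
   makes it adjacent to [v3]. *)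
have [|w /andP[_ v1w]] := deg_in_ex setT [:: v0; v2] v1.
  have /andP[d3 _] := deg3D v1; have := degree_split setT v1.
  by rewrite setCT (deg_inE set0) big_set0 addn0 => <-.
rewrite !inE negb_or => /andP[nw0 nw2].
have wH : w \in H by rewrite inH; apply/negP => /v1_C/(_ v1w).
have wH' : w \in H'.
  by rewrite inE wH ltnNge; apply/negP => w1; apply: v1_leaf v1w.
have [w0|w2|wv3] := nv1 w wH' v1w; [by rewrite w0 eqxx in nw0|by rewrite w2 eqxx in nw2|].
have nw1 : v1 != w by apply: contraTneq v1w => ->; rewrite e_irr.
have nw3 : w != v3 by apply: contraTneq wv3 => ->; rewrite e_irr.
have c6 : graph_cycle e [:: v0; v1; w; v3; v2; p].
  split => //; rewrite /ucycle /= v01 v1w wv3 v32 pq v2q e_sym -pq v0p /=.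
  rewrite !inE !negb_or n01 n02 n03 n12 n13 nw1 nw2 nw3 !notC // !andbT.
  by rewrite [v0 == w]eq_sym nw0 eq_sym n23.
have c4 : graph_cycle e [:: v0; v1; v2; v3].
  split => //; rewrite /ucycle /= v01 v12 v23 v30.
  by rewrite !inE !negb_or n01 n02 n03 n12 n13 n23.
(* The 6-cycle passes through all vertices of the 4-cycle, so six vertices carry both lengths. *)
set S := [set y in [:: v0; v1; w; v3; v2; p]].
have cardS : #|S| = 6 by rewrite card_seq_set //; case: c6 => /andP[].
apply: (dense_cyclic S); last first.
  by right; rewrite cardS; split => //; apply: cycle_deg_sum c6.
apply: (acyclicC S _ _ c4 c6) => //.
  by move=> z; rewrite !inE => /or4P[]->; rewrite ?orbT.
by move=> z zc; rewrite inE.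
Qed.

End EqualLengths.

End Graph.

(** * From minimum and maximum degree to bounds at every vertex *)

Lemma min_degree_le (T : finType) (e : rel T) x : min_degree e <= degree e x.
Proof.
rewrite /min_degree; elim: (index_enum T) (mem_index_enum x) => [//|y r IH].
rewrite inE big_cons geq_min => /orP[/eqP->|/IH->]; first by rewrite leqnn.
exact: orbT.
Qed.

Theorem theorem2p19 (D : nat) (hD : 3 <= D) (T : finType) (e : rel T)
    (he : simple_graph e) (hcard : 20 * D - 46 < #|T|)
    (hmin : 3 <= min_degree e) (hminmax : min_degree e <= max_degree e)
    (hmax : max_degree e <= D) :
  exists c1 c2 : seq T,
    [/\ graph_cycle e c1, graph_cycle e c2,
        [disjoint c1 & c2] & size c1 != size c2].
Proof.
have [e_sym e_irr] := he.
have deg3D x : 3 <= degree e x <= D.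
  apply/andP; split; last by apply: leq_trans hmax; apply: leq_bigmax.
  by apply: leq_trans hmin (min_degree_le _ _ _).
apply: NNPP => no_cycles.
have eq_len c1 c2 : graph_cycle e c1 -> graph_cycle e c2 ->
    [disjoint c1 & c2] -> size c1 = size c2.
  move=> cc1 cc2 dj; apply/eqP; apply: contraT => ne.
  by case: no_cycles; exists c1, c2.
have T0 : [set: T] != set0 by rewrite -card_gt0 cardsT (leq_trans _ hcard).
have [|c cc cmin] := shortest_cycle _ e e_sym e_irr _ T0.
  move=> x _; have /andP[d3 _] := deg3D x.
  have := degree_split T e setT x.
  by rewrite setCT (deg_inE T e set0) big_set0 addn0 => <-; apply: leq_trans d3.
exact: (equal_lengths_absurd _ _ e_sym e_irr _ hD deg3D hcard eq_len c).
Qed.
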